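(* Let $s,t$ be integers, let $(U_n)_{n\ge 0}$ be the Lucas sequence and $(P_n)_{n\ge 1}$ the sequence of Lucas atoms associated with $(s,t)$. (i) If $2\nmid t$ and $2\mid s$ (i.e., $2\mid\Delta$ and $\rho(2,U)=2$), then \[ v_2(P_n)=\begin{cases} v_2(U_2) & \text{if } n=2,\\ 1 & \text{if } n=2^h,\ h\ge 2,\\ 0 & \text{otherwise.}\end{cases} \] (ii) If $2\nmid t$ and $2\nmid s$ (i.e., $2\nmid\Delta$ and $\rho(2,U)=3$), then \[ v_2(P_n)=\begin{cases} v_2(U_3) & \text{if } n=3,\\ v_2(U_6)-v_2(U_3) & \text{if } n=6,\\ 1 & \text{if } n=3\cdot 2^h,\ h\ge 2,\\ 0 & \text{otherwise.}\end{cases} \]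
   Context: Lucas sequence: for integers $s,t$, $U_0=0$, $U_1=1$, $U_n=sU_{n-1}+tU_{n-2}$ for $n\ge 2$. $\Delta=s^2+4t$ is the discriminant of its characteristic polynomial $X^2-sX-t$, and $\rho(2,U)$ is the rank of appearance of $2$ in $(U_m)_{m\ge 0}$, i.e. the minimum positive integer $k$ such that $2\mid U_k$. Lucas atoms: for $n\ge 1$ let $\Phi_n(\alpha,\beta)=\prod_{1\le j\le n,\ \gcd(j,n)=1}(\alpha-\omega^j\beta)$, with $\omega$ a primitive $n$-th root of unity (the homogenization of the $n$-th cyclotomic polynomial). Put $P_1(s,t)=1$, and for $n\ge 2$ let $P_n(s,t)\in\mathbb Z[s,t]$ be the polynomial with $P_n(\alpha+\beta,-\alpha\beta)=\Phi_n(\alpha,\beta)$ as polynomials in the variables $\alpha,\beta$. For integers $s,t$, $P_n$ denotes the integer value $P_n(s,t)$, for $n\ge 1$. $v_2$ denotes the $2$-adic valuation.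
   Formalization: In (ii), the case n = 6 is stated only when U_3 is nonzero, because for U_3 = 0 (e.g. s = 1, t = -1) also U_6 = 0 and v_2(U_6) - v_2(U_3) is undefined; v_2(0) is read as +infinity. *)

(* Defs.v *)
From HB Require Import structures.
From mathcomp Require Import all_boot all_order all_fingroup all_algebra all_field.
From mathcomp Require Import mpoly.
From mathcomp Require Import constructive_ereal.

Set Implicit Arguments.
Unset Strict Implicit.
Unset Printing Implicit Defensive.

Import Order.TTheory GRing.Theory Num.Theory.
Local Open Scope ring_scope.

Fixpoint lucas (s t : int) (n : nat) : int :=
  match n with
  | 0 => 0
  | 1 => 1
  | (n''.+1 as n').+1 => s * lucas s t n' + t * lucas s t n''
  end.

Definition discriminant (s t : int) : int := s ^+ 2 + 4 * t.

Definition rank_of_appearance (p : int) (u : nat -> int) (k : nat) : Prop :=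
  [/\ (0 < k)%N, (p %| u k)%Z
    & forall m, (0 < m < k)%N -> ~~ (p %| u m)%Z].

(* Takes values in the extended integers, so that v2 0 = +oo.  In \bar int,
   +oo - +oo is not +oo: a difference of valuations is meaningful only when
   the subtracted one is finite. *)
Definition v2 (x : int) : \bar int :=
  if x == 0 then +oo%E else ((logn 2 `|x|%N)%:Z)%:E.

(* Here 'X_0 and 'X_1 are the variables alpha and beta; w is meant to be a
   primitive n-th root of unity. *)
Definition hom_cyclotomic (w : algC) (n : nat) : {mpoly algC[2]} :=
  \prod_(1 <= j < n.+1 | coprime j n) ('X_0 - (w ^+ j)%:MP * 'X_1).

(* In p the variables 'X_0 and 'X_1 stand for s and t.  The case n = 0 is
   included in the first branch only to make the definition total. *)
Definition is_lucas_atom (n : nat) (p : {mpoly int[2]}) : Prop :=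
  if (n <= 1)%N then p = 1 else
  forall w : algC, n.-primitive_root w ->
    map_mpoly intr (p \mPo [tuple 'X_0 + 'X_1; - ('X_0 * 'X_1)]) =
      hom_cyclotomic w n.

(* For every n there is exactly one p such that is_lucas_atom n p. *)
Section LucasAtomExistence.

Let lucas_subst : 2.-tuple {mpoly int[2]} :=
  [tuple 'X_0 + 'X_1; - ('X_0 * 'X_1)].
Let neg_subst : 2.-tuple {mpoly int[2]} := [tuple 'X_0; - 'X_1].
Let esym_subst : 2.-tuple {mpoly int[2]} := [tuple mesym 2 int i.+1 | i < 2].

Lemma comp_mpoly_comp (a b c : 2.-tuple {mpoly int[2]}) (p : {mpoly int[2]}) :
  (forall i, tnth a i \mPo b = tnth c i) -> (p \mPo a) \mPo b = p \mPo c.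
Proof.
move=> abc; rewrite [p \mPo a]comp_mpolyEX [p \mPo c]comp_mpolyEX.
rewrite raddf_sum /=; apply: eq_bigr => m _.
rewrite comp_mpolyZ !comp_mpolyX rmorph_prod /=; congr (_ *: _).
by apply: eq_bigr => i _; rewrite rmorphXn /= abc.
Qed.

Let ord2P (P : 'I_2 -> Prop) : P 0 -> P 1 -> forall i, P i.
Proof.
move=> P0 P1 [[|[|//]] lti].
  by rewrite (_ : Ordinal lti = 0) //; apply: val_inj.
by rewrite (_ : Ordinal lti = 1) //; apply: val_inj.
Qed.

Let esym_substE0 : tnth esym_subst 0 = 'X_0 + 'X_1.
Proof. by rewrite tnth_mktuple mesym1E !big_ord_recl big_ord0 addr0. Qed.

Let esym_substE1 : tnth esym_subst 1 = 'X_0 * 'X_1.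
Proof. by rewrite tnth_mktuple mesymnnE !big_ord_recl big_ord0 mulr1. Qed.

Let neg_esym p : (p \mPo neg_subst) \mPo esym_subst = p \mPo lucas_subst.
Proof.
apply: comp_mpoly_comp; apply: ord2P.
  by rewrite /= comp_mpolyXU -tnth_nth esym_substE0.
by rewrite /= comp_mpolyN comp_mpolyXU -tnth_nth esym_substE1.
Qed.

Let neg_neg p : (p \mPo neg_subst) \mPo neg_subst = p.
Proof.
rewrite -[RHS]comp_mpoly_id; apply: comp_mpoly_comp; apply: ord2P.
  by rewrite tnth_mktuple /= comp_mpolyXU.
by rewrite tnth_mktuple /= comp_mpolyN comp_mpolyXU opprK.
Qed.

Let intr_mpoly_inj : injective (@map_mpoly 2 int algC intr).
Proof.
move=> p q /mpolyP epq; apply/mpolyP => m; have := epq m.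
by rewrite !mcoeff_map_mpoly => /intr_inj.
Qed.

Lemma lucas_atom_unique n (p q : {mpoly int[2]}) :
  is_lucas_atom n p -> is_lucas_atom n q -> p = q.
Proof.
rewrite /is_lucas_atom; case: leqP => [_ -> -> //|n_gt1 hp hq].
have [w prim_w] := C_prim_root_exists (ltnW n_gt1).
have := hp w prim_w; rewrite -(hq w prim_w) => /intr_mpoly_inj.
rewrite -/lucas_subst -!neg_esym => /msym_fundamental_un.
by move/(congr1 (fun r => r \mPo neg_subst)); rewrite !neg_neg.
Qed.

(* The homogenization of p in degree d, evaluated at (x, y). *)
Let hom (R : comNzRingType) (d : nat) (p : {poly R}) (x y : R) : R :=
  \sum_(i < d.+1) p`_i * x ^+ i * y ^+ (d - i).

Let homXsubC (R : comNzRingType) d (p : {poly R}) c x y : (size p <= d.+1)%N ->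
  hom d.+1 (('X - c%:P) * p) x y = (x - c * y) * hom d p x y.
Proof.
move=> szp; rewrite mulrBl mulrBl /hom.
under eq_bigr => i _ do rewrite coefB coefXM coefCM !mulrBl.
rewrite sumrB; congr (_ - _).
  rewrite big_ord_recl /= !mul0r add0r mulr_sumr; apply: eq_bigr => i _.
  rewrite /= subSS exprS; rewrite !mulrA; congr (_ * _ * _).
  by rewrite mulrC.
rewrite big_ord_recr /= [p`_d.+1]nth_default // mulr0 !mul0r addr0 mulr_sumr.
apply: eq_bigr => i _; rewrite subSn -1?ltnS // exprS.
rewrite -!mulrA; congr (_ * _); rewrite [RHS]mulrC -!mulrA; congr (_ * _).
by congr (_ * _); rewrite mulrC.
Qed.

Let hom_prod (R : comNzRingType) (s : seq R) x y :
  hom (size s) (\prod_(c <- s) ('X - c%:P)) x y = \prod_(c <- s) (x - c * y).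
Proof.
elim: s => [|c s IHs].
  by rewrite /hom !big_nil big_ord_recl big_ord0 coef1 !mulr1 addr0.
by rewrite !big_cons /= homXsubC ?IHs // size_prod_XsubC.
Qed.

Let int_hom n : {mpoly int[2]} :=
  \sum_(i < (totient n).+1)
    ('Phi_n)`_i *: ('X_0 ^+ i * 'X_1 ^+ (totient n - i)).

Let hom_cyclotomicE w n : (n > 1)%N -> hom_cyclotomic w n =
  \prod_(k < n | coprime k n) ('X_0 - (w ^+ k)%:MP * 'X_1).
Proof.
move=> n_gt1; rewrite /hom_cyclotomic.
rewrite -(big_mkord (fun k => coprime k n)
           (fun k => 'X_0 - (w ^+ k)%:MP * 'X_1)).
have n0 : coprime 0 n = false by rewrite /coprime gcd0n gtn_eqF.
have nn : coprime n n = false by rewrite /coprime gcdnn gtn_eqF.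
rewrite big_mkcond big_nat_recr ?nn ?mulr1 -?big_mkcond /=; last exact: ltnW.
by rewrite [RHS]big_ltn_cond ?n0 ?mulr1 // ltnW.
Qed.

Let map_int_hom (w : algC) n : (n > 1)%N -> n.-primitive_root w ->
  map_mpoly intr (int_hom n) = hom_cyclotomic w n.
Proof.
move=> n_gt1 prim_w; rewrite hom_cyclotomicE //.
pose s := [seq (w ^+ k)%:MP_[2]
          | k : 'I_n <- [seq k : 'I_n <- index_enum 'I_n | coprime k n]].
have -> : \prod_(k < n | coprime k n) ('X_0 - (w ^+ k)%:MP * 'X_1)
   = \prod_(c <- s) ('X_0 - c * 'X_1).
  by rewrite /s big_map big_filter.
have map_prod : map_poly (@mpolyC 2 algC) (cyclotomic w n)
    = \prod_(c <- s) ('X - c%:P).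
  rewrite /s big_map big_filter rmorph_prod /=.
  by apply: eq_bigr => k _; rewrite rmorphB /= map_polyX map_polyC.
have szs : size s = totient n.
  have := size_prod_XsubC s id; rewrite -map_prod.
  rewrite size_map_inj_poly ?mpolyC0 //; last by move=> x y /(congr1 (mcoeff 0%MM)); rewrite !mcoeffC eqxx !mulr1.
  by rewrite size_cyclotomic => -[].
rewrite -hom_prod szs /int_hom /hom rmorph_sum /=; apply: eq_bigr => i _.
rewrite map_mpolyZ rmorphM !rmorphXn /= !map_mpolyX -map_prod.
by rewrite coef_map /= -(Cintr_Cyclotomic prim_w) coef_map /= -mul_mpolyC mulrA.
Qed.

Let msymXU (R : nzRingType) (s : 'S_2) i : msym s ('X_i : {mpoly R[2]}) = 'X_(s i).
Proof. by rewrite /msym mmapX mmap1U. Qed.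

Let hom_cyclotomic_swap (w : algC) n : (n > 1)%N -> n.-primitive_root w ->
  msym (tperm 0 1) (hom_cyclotomic w n) = hom_cyclotomic w n.
Proof.
move=> n_gt1 prim_w; have n_gt0 := ltnW n_gt1.
have w_neq0 : w != 0.
  apply: contra_eq_neq (prim_expr_order prim_w) => ->.
  by rewrite expr0n gtn_eqF // eq_sym oner_eq0.
have wV : w^-1 = w ^+ n.-1.
  apply: (mulIf w_neq0).
  by rewrite mulVf // -exprSr prednK // (prim_expr_order prim_w).
have prim_wV : n.-primitive_root w^-1.
  by rewrite wV (prim_root_exp_coprime _ prim_w) -{2}(prednK n_gt0) coprimenS.
have swapE0 : msym (tperm 0 1) (hom_cyclotomic w n)
    = \prod_(k < n | coprime k n) ('X_1 - (w ^+ k)%:MP * 'X_0).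
  rewrite hom_cyclotomicE // rmorph_prod /=; apply: eq_bigr => k _.
  rewrite msymB msymM !msymXU tpermL tpermR; congr (_ - _ * _).
  by rewrite /msym mmapC.
pose c := \prod_(k < n | coprime k n) (- (w ^+ k)).
have swapE : msym (tperm 0 1) (hom_cyclotomic w n) = c *: hom_cyclotomic w n.
  rewrite swapE0 -(map_int_hom n_gt1 prim_w) (map_int_hom n_gt1 prim_wV).
  rewrite hom_cyclotomicE // /c -mul_mpolyC rmorph_prod -big_split /=.
  apply: eq_bigr => k _; rewrite mulrBr mulrA -mpolyCM exprVn mulNr.
  by rewrite divff ?expf_neq0 // !rmorphN /= rmorph1 mulN1r mulNr opprK addrC.
have val_neq0 : (hom_cyclotomic w n).@[fun=> 1] != 0.
  rewrite hom_cyclotomicE // rmorph_prod /=; apply/prodf_neq0 => k co_k.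
  rewrite mevalB mevalM mevalC !mevalXU mulr1 subr_eq0 eq_sym.
  rewrite -(prim_order_dvd prim_w); apply: contraL co_k => /gcdn_idPr.
  by rewrite /coprime => ->; rewrite gtn_eqF.
have c1 : c = 1.
  apply: (mulIf val_neq0); rewrite mul1r -mevalZ -swapE swapE0.
  rewrite hom_cyclotomicE // !rmorph_prod /=; apply: eq_bigr => k _.
  by rewrite !mevalB !mevalM !mevalC !mevalXU.
by rewrite swapE c1 scale1r.
Qed.

Let perm2P (s : 'S_2) : s = 1%g \/ s = tperm 0 1.
Proof.
have s01 : s 0 != s 1 by rewrite (inj_eq perm_inj).
have [s0|s0] : s 0 = 0 \/ s 0 = 1 by move: (s 0); apply: ord2P; [left|right].
  left; apply/permP; apply: ord2P; rewrite perm1 //.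
  by move: s01; rewrite s0; move: (s 1); apply: ord2P.
right; apply/permP; apply: ord2P; rewrite ?tpermL ?tpermR //.
by move: s01; rewrite s0; move: (s 1); apply: ord2P.
Qed.

Let map_msym s (p : {mpoly int[2]}) :
  map_mpoly (intr : int -> algC) (msym s p) = msym s (map_mpoly intr p).
Proof.
by apply/mpolyP => m; rewrite mcoeff_map_mpoly !mcoeff_sym mcoeff_map_mpoly.
Qed.

Lemma lucas_atom_exists n : {p : {mpoly int[2]} | is_lucas_atom n p}.
Proof.
rewrite /is_lucas_atom; case: leqP => [_|n_gt1]; first by exists 1.
have [w prim_w] := C_prim_root_exists (ltnW n_gt1).
have sym_hom : int_hom n \is symmetric.
  apply/issymP => s; apply: intr_mpoly_inj.
  rewrite map_msym (map_int_hom n_gt1 prim_w).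
  have [->|->] := perm2P s; last exact: hom_cyclotomic_swap.
  by apply/mpolyP => m; rewrite mcoeff_sym mperm1.
have [t [tS _]] := sym_fundamental sym_hom.
exists (t \mPo neg_subst) => w' prim_w'.
rewrite -/lucas_subst -neg_esym neg_neg tS; exact: map_int_hom.
Qed.

End LucasAtomExistence.

Definition lucas_atom (n : nat) (s t : int) : int :=
  (sval (lucas_atom_exists n)).@[tnth [tuple s; t]].

(* Main.v *)
(* P_n(s,t) is the product of a - w^k b over k < n prime to n, where a, b are
   the roots of X^2 - s X - t. For a prime p, write (s_p, t_p) for the
   parameters whose roots are a^p, b^p. Grouping the factors according to
   k modulo m gives
     P_{pm}(s,t) = P_m(s_p,t_p)               if p divides m,
     P_{pm}(s,t) * P_m(s,t) = P_m(s_p,t_p)    otherwise.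
   If s is even and t odd, doubling (p = 2) reduces everything to P_2 = s and
   to odd n; for odd n > 1, P_n(s,t) is congruent modulo 2 to
   P_n(2,-1) = Phi_n(1), a divisor of n. If s and t are odd then s_3 is even
   and t_3 odd, so tripling (p = 3) reduces case (ii) to case (i). *)
Require Import Defs.
From HB Require Import structures.
From mathcomp Require Import all_boot all_order all_fingroup all_algebra all_field.
From mathcomp Require Import mpoly.
From mathcomp Require Import constructive_ereal.
From mathcomp Require Import zify ring.

Set Implicit Arguments.
Unset Strict Implicit.
Unset Printing Implicit Defensive.

Import Order.TTheory GRing.Theory Num.Theory.
Local Open Scope ring_scope.

(** * Products over powers of a primitive root of unity *)

(** Homogenizes the factorization of [X^n - 1]: evaluate it at [x / y] and multiply by [y ^+ n],
    with [y = 0] treated apart. *)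
Lemma prim_root_prodXsubY (F : fieldType) (n : nat) (z x y : F) :
  n.-primitive_root z -> \prod_(0 <= i < n) (x - z ^+ i * y) = x ^+ n - y ^+ n.
Proof.
move=> prim_z; have n_gt0 := prim_order_gt0 prim_z.
have [->|y_neq0] := eqVneq y 0.
  under eq_bigr do rewrite mulr0 subr0.
  by rewrite prodr_const_nat subn0 expr0n gtn_eqF // subr0.
have := congr1 (fun p => p.[x / y] * y ^+ n) (factor_Xn_sub_1 prim_z).
rewrite horner_prod !hornerE mulrBl mul1r expr_div_n divfK ?expf_neq0 // => <-.
rewrite -[in y ^+ n](subn0 n) -prodr_const_nat -big_split /=.
by apply: eq_bigr => i _; rewrite !hornerE mulrBl divfK.
Qed.

(** Coprimality to [m] depends only on the residue modulo [m]. For a fixed residue [k], the factors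
    with indices [k + i * m] multiply to a difference of [p]-th powers, because [w ^+ m] is a
    primitive [p]-th root of unity. *)
Lemma prod_coprime_mul (F : fieldType) (p m : nat) (w a b : F) :
    (0 < p)%N -> (p * m).-primitive_root w ->
  \prod_(0 <= k < p * m | coprime k m) (a - w ^+ k * b) =
  \prod_(0 <= k < m | coprime k m) (a ^+ p - (w ^+ p) ^+ k * b ^+ p).
Proof.
move=> p_gt0 prim_w.
have m_gt0 : (0 < m)%N by move: (prim_order_gt0 prim_w); rewrite muln_gt0 => /andP[].
have prim_wm : p.-primitive_root (w ^+ m).
  by have := dvdn_prim_root prim_w (dvdn_mulr m (dvdnn p)); rewrite mulKn.
rewrite big_mkcond big_nat_mul /=.
under eq_bigr => i _.
  rewrite -[X in \big[_/_]_(X <= _ < _) _]add0n big_addn mulSn addnK.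
  over.
rewrite exchange_big_nat /= [RHS]big_mkcond /=; apply: eq_bigr => k _.
have coE i : coprime (k + i * m) m = coprime k m.
  by rewrite addnC /coprime gcdnC gcdnMDl gcdnC.
under eq_bigr do rewrite coE.
case: ifP => _; last by rewrite big1.
rewrite -exprM mulnC [in RHS]exprM -exprMn -(prim_root_prodXsubY _ _ prim_wm).
by apply: eq_bigr => i _; rewrite mulrA exprD mulnC exprM [_ * w ^+ k]mulrC.
Qed.

Lemma prod_coprime_dvd (F : fieldType) (p m : nat) (w a b : F) : (0 < p)%N ->
  \prod_(0 <= k < p * m | coprime k m && (p %| k)%N) (a - w ^+ k * b) =
  \prod_(0 <= j < m | coprime (j * p) m) (a - (w ^+ p) ^+ j * b).
Proof.
move=> p_gt0; rewrite big_mkcond mulnC big_nat_mul [RHS]big_mkcond /=.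
apply: eq_bigr => j _.
(* In the block [j * p <= k < j.+1 * p] only the first index is a multiple of [p]. *)
rewrite big_ltn; last by rewrite ltn_mul2r p_gt0 /=.
rewrite dvdn_mull // andbT big_nat_cond big1 ?mulr1.
  by case: ifP => // _; rewrite mulnC exprM.
move=> k; rewrite andbT => /andP[ltk gtk]; case: ifP => // /andP[_ /dvdnP[q kE]].
by move: ltk gtk; rewrite kE !ltn_mul2r p_gt0 /= ltnS => jq /(leq_trans jq); rewrite ltnn.
Qed.

(** * Lucas atoms as products over the complex characteristic roots *)

Lemma meval_map_mpoly (k : nat) (R S : comNzRingType) (f : {rmorphism R -> S})
    (u : 'I_k -> R) (q : {mpoly R[k]}) :
  (map_mpoly f q).@[f \o u] = f q.@[u].
Proof.
rewrite /map_mpoly /mmap raddf_sum mevalE raddf_sum; apply: eq_bigr => m _ /=.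
rewrite mmap1_id mevalM mevalC mevalX rmorphM rmorph_prod /=.
by congr (_ * _); apply: eq_bigr => i _; rewrite rmorphXn.
Qed.

(** The identity defining the atom is evaluated at the complex point [(a, b)], where the substituted
    variables become [s] and [t]. *)
Lemma lucas_atomE (s t : int) (a b w : algC) (n : nat) :
    a + b = s%:~R -> a * b = - t%:~R -> (1 < n)%N -> n.-primitive_root w ->
  (lucas_atom n s t)%:~R = \prod_(0 <= k < n | coprime k n) (a - w ^+ k * b).
Proof.
move=> abD abM n_gt1 prim_w; rewrite /lucas_atom.
case: (lucas_atom_exists n) => p /=; rewrite /is_lucas_atom leqNgt n_gt1 /=.
move=> /(_ w prim_w) /(congr1 (meval (tnth [tuple a; b]))).
rewrite map_mpoly_comp; last exact: intr_inj.
rewrite comp_mpoly_meval => p_meval.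
transitivity (hom_cyclotomic w n).@[tnth [tuple a; b]]; last first.
  rewrite /hom_cyclotomic rmorph_prod /=.
  (* The definition runs over [1 <= j <= n], the goal over [0 <= k < n]; for [n > 1] neither [0] nor
     [n] is coprime to [n]. *)
  have n0 : coprime 0 n = false by rewrite /coprime gcd0n gtn_eqF.
  have nn : coprime n n = false by rewrite /coprime gcdnn gtn_eqF.
  rewrite big_mkcond big_nat_recr ?nn -?big_mkcond /=; last exact: ltnW.
  rewrite [RHS]big_ltn_cond ?n0 1?ltnW // mulr1; apply: eq_bigr => k _.
  by rewrite mevalB mevalM mevalC !mevalXU !(tnth_nth 0).
rewrite -meval_map_mpoly -p_meval; apply: meval_eq => -[[|[|//]] i].
  by rewrite /= !(tnth_nth 0) /= rmorphD /= !map_mpolyX mevalD !mevalXU !(tnth_nth 0).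
rewrite /= !(tnth_nth 0) /= rmorphN rmorphM /= !map_mpolyX.
by rewrite mevalN mevalM !mevalXU !(tnth_nth 0) /= abM opprK.
Qed.

Lemma lucas_roots (s t : int) :
  exists a b : algC, a + b = s%:~R /\ a * b = - t%:~R.
Proof.
pose c : algC := sqrtC ((s ^+ 2 + 4 * t)%:~R).
have c2 : c ^+ 2 = s%:~R ^+ 2 + 4 * t%:~R.
  by rewrite sqrtCK !(rmorphD, rmorphXn, rmorphM).
exists ((s%:~R + c) / 2), ((s%:~R - c) / 2); split; first by field.
have -> : (s%:~R + c) / 2 * ((s%:~R - c) / 2) = (s%:~R ^+ 2 - c ^+ 2) / 4 by field.
by rewrite c2; field.
Qed.

(** * Multiplying the index by a prime *)

(* The p-th powers of the roots of X^2 - s X - t are the roots of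
   X^2 - s' X - t'. *)
Definition power_params (p : nat) (s t s' t' : int) : Prop :=
  forall a b : algC, a + b = s%:~R -> a * b = - t%:~R ->
    a ^+ p + b ^+ p = s'%:~R /\ a ^+ p * b ^+ p = - t'%:~R.

Lemma power_params2 (s t : int) : power_params 2 s t (s ^+ 2 + 2 * t) (- t ^+ 2).
Proof.
move=> a b abD abM; rewrite !(rmorphN, rmorphD, rmorphXn, rmorphM) /= opprK -abD.
by split; [rewrite -[t%:~R]opprK -abM|rewrite -sqrrN -abM]; ring.
Qed.

Lemma power_params3 (s t : int) :
  power_params 3 s t (s ^+ 3 + 3 * s * t) (t ^+ 3).
Proof.
move=> a b abD abM; rewrite !(rmorphD, rmorphXn, rmorphM) /= -abD.
by rewrite -[t%:~R]opprK -abM; split; ring.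
Qed.

Arguments power_params2 : clear implicits.
Arguments power_params3 : clear implicits.

(** When [p] divides [m], being coprime to [p * m] is the same as being coprime to [m]. *)
Lemma lucas_atom_mul_dvd (p m : nat) (s t s' t' : int) :
    power_params p s t s' t' -> (1 < m)%N -> (0 < p)%N -> (p %| m)%N ->
  lucas_atom (p * m) s t = lucas_atom m s' t'.
Proof.
move=> pst m_gt1 p_gt0 p_m; have [a [b [abD abM]]] := lucas_roots s t.
have [abpD abpM] := pst a b abD abM.
have pm_gt1 : (1 < p * m)%N by rewrite (leq_trans m_gt1) // leq_pmull.
have [w prim_w] := C_prim_root_exists (ltnW pm_gt1).
have prim_wp : m.-primitive_root (w ^+ p).
  by have := dvdn_prim_root prim_w (dvdn_mull p (dvdnn m)); rewrite mulnK 1?ltnW.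
apply: (@intr_inj algC).
rewrite (lucas_atomE abD abM pm_gt1 prim_w) (lucas_atomE abpD abpM m_gt1 prim_wp).
rewrite -(prod_coprime_mul a b p_gt0 prim_w); apply: eq_bigl => k.
rewrite coprimeMr andb_idl // => /coprime_dvdr; exact.
Qed.

(** Among the [k < p * m] coprime to [m], those not divisible by [p] give the atom of index [p * m];
    the multiples [k = j * p] give the atom of index [m], with primitive root [w ^+ p]. *)
Lemma lucas_atom_mul_prime (p m : nat) (s t s' t' : int) :
    power_params p s t s' t' -> (1 < m)%N -> prime p -> ~~ (p %| m)%N ->
  lucas_atom (p * m) s t * lucas_atom m s t = lucas_atom m s' t'.
Proof.
move=> pst m_gt1 p_prime p_m; have [a [b [abD abM]]] := lucas_roots s t.
have p_gt0 := prime_gt0 p_prime; have [abpD abpM] := pst a b abD abM.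
have pm_gt1 : (1 < p * m)%N by rewrite (leq_trans m_gt1) // leq_pmull.
have [w prim_w] := C_prim_root_exists (ltnW pm_gt1).
have prim_wp : m.-primitive_root (w ^+ p).
  by have := dvdn_prim_root prim_w (dvdn_mull p (dvdnn m)); rewrite mulnK 1?ltnW.
apply: (@intr_inj algC); rewrite rmorphM /=.
rewrite (lucas_atomE abD abM pm_gt1 prim_w) (lucas_atomE abpD abpM m_gt1 prim_wp).
rewrite (lucas_atomE abD abM m_gt1 prim_wp) -(prod_coprime_mul a b p_gt0 prim_w).
rewrite [RHS](bigID (fun k => p %| k)%N) /= prod_coprime_dvd // mulrC.
congr (_ * _); apply: eq_bigl => k.
  by rewrite coprimeMl (prime_coprime _ p_prime) p_m andbT.
by rewrite coprimeMr andbC [coprime k p]coprime_sym (prime_coprime _ p_prime).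
Qed.

(** * Atoms of index 1, 2 and 3 *)

Lemma lucas_atom1 (s t : int) : lucas_atom 1 s t = 1.
Proof.
by rewrite /lucas_atom; case: (lucas_atom_exists 1) => p /= ->; rewrite meval1.
Qed.

Lemma lucas_atom2 (s t : int) : lucas_atom 2 s t = s.
Proof.
have [a [b [abD abM]]] := lucas_roots s t.
have [w prim_w] := C_prim_root_exists (isT : (0 < 2)%N).
apply: (@intr_inj algC); rewrite (lucas_atomE abD abM _ prim_w) //.
rewrite unlock /= mulr1 expr1 -abD.
have /eqP := prim_expr_order prim_w; rewrite sqrf_eq1 => /pred2P[w1|->].
  by have := prim_order_dvd prim_w 1; rewrite w1 expr1 eqxx.
by rewrite mulN1r opprK.
Qed.

Lemma lucas_atom3 (s t : int) : lucas_atom 3 s t = s ^+ 2 + t.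
Proof.
have [a [b [abD abM]]] := lucas_roots s t.
have [w prim_w] := C_prim_root_exists (isT : (0 < 3)%N).
apply: (@intr_inj algC); rewrite (lucas_atomE abD abM _ prim_w) //.
rewrite unlock /= mulr1 expr1 rmorphD rmorphXn /= -abD -[t%:~R]opprK -abM.
have w2 : w ^+ 2 = - 1 - w.
  have /eqP : (w - 1) * (w ^+ 2 + w + 1) = 0.
    have -> : (w - 1) * (w ^+ 2 + w + 1) = w ^+ 3 - 1 by ring.
    by rewrite (prim_expr_order prim_w) subrr.
  rewrite mulf_eq0 subr_eq0 => /orP[/eqP w1|/eqP w2]; last first.
    by apply/eqP; rewrite -subr_eq0 -w2; apply/eqP; ring.
  by have := prim_order_dvd prim_w 1; rewrite w1 expr1 eqxx.
have -> : (a - w * b) * (a - w ^+ 2 * b) =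
  a ^+ 2 - (w + w ^+ 2) * a * b + w * w ^+ 2 * b ^+ 2 by ring.
have -> : w * w ^+ 2 = 1 by rewrite -exprS (prim_expr_order prim_w).
by rewrite w2; ring.
Qed.

(** * Congruences and parity *)

Lemma lucas_atom_mod (m : int) (n : nat) (s t s' t' : int) :
    (m %| s - s')%Z -> (m %| t - t')%Z ->
  (m %| lucas_atom n s t - lucas_atom n s' t')%Z.
Proof.
rewrite /lucas_atom; case: (lucas_atom_exists n) => p _ /= sE tE.
rewrite !mevalE -sumrB; apply: (big_ind (fun x => m %| x)%Z) => [|x y|e _]; first exact: dvdz0.
  exact: rpredD.
rewrite -mulrBr dvdz_mull // !big_ord_recl !big_ord0 !(tnth_nth 0) /= !mulr1.
set i := e _; set j := e _.
have dX (x y : int) k : (m %| x - y)%Z -> (m %| x ^+ k - y ^+ k)%Z.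
  by move=> xy; rewrite subrXX dvdz_mulr.
have -> : s ^+ i * t ^+ j - s' ^+ i * t' ^+ j =
  (s ^+ i - s' ^+ i) * t ^+ j + s' ^+ i * (t ^+ j - t' ^+ j) by ring.
by apply: rpredD; [apply: dvdz_mulr|apply: dvdz_mull]; apply: dX.
Qed.

(* At (2, -1) both characteristic roots are 1, so that P_n = Phi_n(1). *)
Lemma lucas_atom_equal_roots_dvd (n : nat) : (1 < n)%N ->
  (lucas_atom n 2 (-1) %| n%:Z)%Z.
Proof.
move=> n_gt1; have n_gt0 := ltnW n_gt1.
have [w prim_w] := C_prim_root_exists n_gt0.
have -> : lucas_atom n 2 (-1) = ('Phi_n).[1].
  apply: (@intr_inj algC).
  rewrite (@lucas_atomE 2 (-1) 1 1 w) ?mul1r ?rmorphN1 ?opprK //.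
  rewrite -horner_map /= (Cintr_Cyclotomic prim_w) rmorph1 /cyclotomic.
  rewrite horner_prod big_mkord; apply: eq_bigr => k _.
  by rewrite !hornerE.
have Phi1 : 'Phi_1 = 'X - 1.
  by have := prod_Cyclotomic (ltn0Sn 0); rewrite big_seq1.
(* Differentiate ['X^n - 1 = 'Phi_n * R] at 1. The factor ['Phi_1] makes [R] vanish there, so [n] is
   ['Phi_n.[1]] times the derivative of [R] at 1. *)
have := congr1 (fun p => p^`().[1]) (prod_Cyclotomic n_gt0).
rewrite (bigD1_seq n) ?divisors_uniq -?dvdn_divisors //= derivM derivB derivXn derivC.
set R := \prod_(d <- _ | _) _; have R1 : R.[1] = 0.
  apply/eqP; rewrite horner_prod prodf_seq_eq0; apply/hasP; exists 1%N.
    by rewrite -dvdn_divisors.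
  by rewrite ltn_eqF // Phi1 !hornerE subrr eqxx.
rewrite !hornerE R1 mulr0 add0r hornerMn hornerXn expr1n natz => <-; exact: dvdz_mulr.
Qed.

Lemma dvd2zM (x y : int) : (2 %| x * y)%Z = (2 %| x)%Z || (2 %| y)%Z.
Proof. by rewrite !dvdzE abszM Euclid_dvdM. Qed.

Lemma dvd2z_double_params (s t : int) :
  ((2 %| s ^+ 2 + 2 * t)%Z = (2 %| s)%Z) * ((2 %| - t ^+ 2)%Z = (2 %| t)%Z).
Proof.
have := dvd2zM s s; have := dvd2zM t t; rewrite !orbb -!expr2 => t2 s2.
split; [rewrite -s2|rewrite -t2]; lia.
Qed.

Lemma dvd2z_triple_params (s t : int) : ~~ (2 %| s)%Z -> ~~ (2 %| t)%Z ->
  (2 %| s ^+ 3 + 3 * s * t)%Z /\ ~~ (2 %| t ^+ 3)%Z.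
Proof.
move=> s_odd t_odd; split; last by rewrite !exprS expr0 !dvd2zM !negb_or t_odd.
have -> : s ^+ 3 + 3 * s * t = s * (s * s + 3 * t) by ring.
rewrite dvd2zM; have := dvd2zM s s; lia.
Qed.

(** * Even [s], odd [t] *)

Lemma lucas_atom_odd_index (n : nat) (s t : int) :
    (0 < n)%N -> odd n -> (2 %| s)%Z -> ~~ (2 %| t)%Z ->
  ~~ (2 %| lucas_atom n s t)%Z.
Proof.
move=> n_gt0 n_odd s_even t_odd.
have [->|n_neq1] := eqVneq n 1%N; first by rewrite lucas_atom1.
have n_gt1 : (1 < n)%N by rewrite ltn_neqAle eq_sym n_neq1.
have s2 : (2 %| s - 2)%Z by lia.
have t1 : (2 %| t - (-1))%Z by lia.
have := lucas_atom_mod n s2 t1.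
have := lucas_atom_equal_roots_dvd n_gt1.
set x := lucas_atom n s t; set y := lucas_atom n _ _ => yn xy.
apply/negP => x2; have y2 : (2 %| y)%Z by lia.
by have := dvdz_trans y2 yn; lia.
Qed.

(** Strong induction by halving an even index [n = 2 * m]. For odd [m] the atom divides one of odd
    index at the doubled parameters; for even [m] it equals the atom of index [m] there. Doubling
    preserves the parities of [s] and [t]. *)
Lemma lucas_atom_even_odd (n : nat) (s t : int) :
    (0 < n)%N -> (2 %| s)%Z -> ~~ (2 %| t)%Z -> n <> 2%N ->
    (forall h, (2 <= h)%N -> n <> (2 ^ h)%N) ->
  ~~ (2 %| lucas_atom n s t)%Z.
Proof.
elim/ltn_ind: n s t => n IHn s t n_gt0 s_even t_odd n2 n2h.
case n_odd : (odd n); first exact: lucas_atom_odd_index.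
have [m nE] : exists m, n = (2 * m)%N by exists n./2; lia.
have m_gt1 : (1 < m)%N by lia.
have [s'_even t'_odd] :
  (2 %| s ^+ 2 + 2 * t)%Z /\ ~~ (2 %| - t ^+ 2)%Z.
  by rewrite !dvd2z_double_params.
have m2h h : (2 <= h)%N -> m <> (2 ^ h)%N.
  by move=> h2 mE; apply: (n2h h.+1); [lia|rewrite nE mE expnS].
case m_odd : (odd m).
  have m_ndvd : ~~ (2 %| m)%N by rewrite dvdn2 m_odd.
  have := lucas_atom_mul_prime (power_params2 s t) m_gt1 isT m_ndvd.
  rewrite -nE => P_m; apply/negP => P_n.
  have := lucas_atom_odd_index (ltnW m_gt1) m_odd s'_even t'_odd.
  by rewrite -P_m dvdz_mulr.
rewrite nE (lucas_atom_mul_dvd (power_params2 s t)) ?dvdn2 ?m_odd //.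
apply: IHn => //; [lia|lia|].
by move=> mE; apply: (n2h 2%N) => //; rewrite nE mE.
Qed.

(** Doubling descends to [P_4(s, t) = s ^+ 2 + 2 * t], which is 2 modulo 4 since [s] is even and [t]
    odd. *)
Lemma lucas_atom_2exp_even (h : nat) (s t : int) :
    (2 %| s)%Z -> ~~ (2 %| t)%Z ->
  (lucas_atom (2 ^ h.+2) s t = 2 %[mod 4])%Z.
Proof.
elim: h s t => [|h IHh] s t s_even t_odd; rewrite expnS.
  rewrite (lucas_atom_mul_dvd (power_params2 s t)) // lucas_atom2.
  have /dvdzP[k ->] := s_even; have [j ->] : exists j, t = j * 2 + 1.
    by exists (t %/ 2)%Z; lia.
  have -> : (k * 2) ^+ 2 + 2 * (j * 2 + 1) = (k ^+ 2 + j) * 4 + 2 by ring.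
  by rewrite modzMDl.
rewrite (lucas_atom_mul_dvd (power_params2 s t))
  ?(@ltn_exp2l 2 0) ?(@dvdn_exp2l 2 1) //.
by apply: IHh; rewrite dvd2z_double_params.
Qed.

(** * Odd [s], odd [t] *)

Lemma lucas_atom_2exp_odd (h : nat) (s t : int) :
  ~~ (2 %| s)%Z -> ~~ (2 %| t)%Z -> ~~ (2 %| lucas_atom (2 ^ h) s t)%Z.
Proof.
elim: h s t => [|[|h] IHh] s t s_odd t_odd; first by rewrite lucas_atom1.
  by rewrite lucas_atom2.
rewrite expnS (lucas_atom_mul_dvd (power_params2 s t))
  ?(@ltn_exp2l 2 0) ?(@dvdn_exp2l 2 1) //.
by apply: IHh; rewrite dvd2z_double_params.
Qed.

(** The atom divides an atom at the tripled parameters, of index [n] if 3 does not divide [n] and of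
    index [n / 3] otherwise. That atom is odd unless its index is a positive power of 2; for [n]
    itself a power of 2, the parity comes from doubling instead. *)
Lemma lucas_atom_odd_odd (n : nat) (s t : int) :
    (0 < n)%N -> ~~ (2 %| s)%Z -> ~~ (2 %| t)%Z -> n <> 3%N -> n <> 6%N ->
    (forall h, (2 <= h)%N -> n <> (3 * 2 ^ h)%N) ->
  ~~ (2 %| lucas_atom n s t)%Z.
Proof.
move=> n_gt0 s_odd t_odd n3 n6 n32h.
have [s'_even t'_odd] := dvd2z_triple_params s_odd t_odd.
have not2exp_even m : (1 < m)%N -> (forall h, m <> 2 ^ h)%N ->
    ~~ (2 %| lucas_atom m (s ^+ 3 + 3 * s * t) (t ^+ 3))%Z.
  move=> m_gt1 m2h; apply: lucas_atom_even_odd => //; first exact: ltnW.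
  exact: (m2h 1%N).
have [/dvdnP[m nE]|n_ndvd] := boolP (3 %| n)%N; last first.
  have [n_le1|n_gt1] := leqP n 1.
    by rewrite (_ : n = 1%N) ?lucas_atom1 //; lia.
  (* Since [h < 2 ^ h], searching exponents up to [n] decides whether [n] is a power of 2. *)
  have [/'exists_eqP[h nE]|] := boolP [exists h : 'I_n.+1, n == 2 ^ h]%N.
    by rewrite nE lucas_atom_2exp_odd.
  rewrite negb_exists => /forallP n2h.
  have {}n2h h : (n <> 2 ^ h)%N.
    move=> nE; have hn : (h < n.+1)%N by rewrite ltnS nE ltnW // ltn_expl.
    by have := n2h (Ordinal hn); rewrite -nE eqxx.
  have := not2exp_even n n_gt1 n2h.
  rewrite -(lucas_atom_mul_prime (power_params3 s t)) //.
  by rewrite dvd2zM negb_or => /andP[].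
(* The exponents 0 and 1 correspond to the excluded indices [n = 3] and [n = 6]. *)
have m2h h : m <> (2 ^ h)%N.
  by case: h => [|[|h]] mE; [lia|lia|]; apply: (n32h h.+2); rewrite // nE mE mulnC.
have m_gt1 : (1 < m)%N by have := m2h 0%N; lia.
have := not2exp_even m m_gt1 m2h; rewrite nE mulnC.
have [m_dvd|m_ndvd] := boolP (3 %| m)%N.
  by rewrite (lucas_atom_mul_dvd (power_params3 s t)).
rewrite -(lucas_atom_mul_prime (power_params3 s t)) //.
by rewrite dvd2zM negb_or => /andP[].
Qed.

(** * Valuations, and assembly of the two cases *)

Lemma v2_odd (x : int) : ~~ (2 %| x)%Z -> v2 x = 0%E.
Proof.
move=> x_odd; have x_neq0 : x != 0 by lia.
rewrite dvdzE in x_odd.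
by rewrite /v2 (negPf x_neq0) lognE (negPf x_odd) !andbF.
Qed.

Lemma v2M (x y : int) : x != 0 -> y != 0 -> v2 (x * y) = (v2 x + v2 y)%E.
Proof.
move=> x0 y0; rewrite /v2 mulf_eq0 (negPf x0) (negPf y0) /= abszM.
by rewrite lognM ?absz_gt0.
Qed.

(** Holds for [x = 0] too, both sides being [+oo]. *)
Lemma v2_mulr_odd (x y : int) : ~~ (2 %| y)%Z -> v2 (x * y) = v2 x.
Proof.
move=> y_odd; have y_neq0 : y != 0 by lia.
have [->|x_neq0] := eqVneq x 0; first by rewrite mul0r.
by rewrite v2M // (v2_odd y_odd) adde0.
Qed.

Lemma v2_mod4 (x : int) : (x = 2 %[mod 4])%Z -> v2 x = 1%E.
Proof.
move=> x2; have -> : x = 2 * (2 * (x %/ 4)%Z + 1) by lia.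
by rewrite v2_mulr_odd //; lia.
Qed.

Theorem theorem15 (s t : int) :
  (* (i) *)
  (~~ (2 %| t)%Z ->
    ((2 %| s)%Z <->
       (2 %| discriminant s t)%Z /\ rank_of_appearance 2 (lucas s t) 2) /\
    ((2 %| s)%Z ->
      [/\ v2 (lucas_atom 2 s t) = v2 (lucas s t 2),
          forall h : nat, (2 <= h)%N -> v2 (lucas_atom (2 ^ h) s t) = 1%E
        & forall n : nat, (1 <= n)%N ->
            n <> 2%N -> (forall h : nat, (2 <= h)%N -> n <> (2 ^ h)%N) ->
            v2 (lucas_atom n s t) = 0%E])) /\
  (* (ii) *)
  (~~ (2 %| t)%Z ->
    (~~ (2 %| s)%Z <->
       ~~ (2 %| discriminant s t)%Z /\ rank_of_appearance 2 (lucas s t) 3) /\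
    (~~ (2 %| s)%Z ->
      [/\ v2 (lucas_atom 3 s t) = v2 (lucas s t 3),
          lucas s t 3 <> 0 ->
            v2 (lucas_atom 6 s t) = (v2 (lucas s t 6) - v2 (lucas s t 3))%E,
          forall h : nat, (2 <= h)%N -> v2 (lucas_atom (3 * 2 ^ h) s t) = 1%E
        & forall n : nat, (1 <= n)%N ->
            n <> 3%N -> n <> 6%N ->
            (forall h : nat, (2 <= h)%N -> n <> (3 * 2 ^ h)%N) ->
            v2 (lucas_atom n s t) = 0%E])).
Proof.
have U2 : lucas s t 2 = s by rewrite /=; ring.
have U3 : lucas s t 3 = s ^+ 2 + t by rewrite /=; ring.
have s2 : (2 %| s ^+ 2)%Z = (2 %| s)%Z by rewrite expr2 dvd2zM orbb.
have disc2 : (2 %| discriminant s t)%Z = (2 %| s)%Z.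
  by rewrite /discriminant -s2; lia.
split=> t_odd; split.
- rewrite disc2; split=> [s_even|[]//]; split=> //; split=> //.
    by rewrite U2.
  by case=> [|[|m]].
- move=> s_even; split.
  + by rewrite lucas_atom2 U2.
  + move=> [|[|h]] // _; apply: v2_mod4; exact: lucas_atom_2exp_even.
  + move=> n n_gt0 n2 n2h; apply: v2_odd; exact: lucas_atom_even_odd.
- rewrite disc2; split=> [s_odd|[]//]; split=> //; split=> //.
    by rewrite U3; lia.
  by case=> [|[|[|m]]] // _; rewrite U2.
move=> s_odd; have [s'_even t'_odd] := dvd2z_triple_params s_odd t_odd.
have s_neq0 : s != 0 by lia.
split.
- by rewrite lucas_atom3 U3.
- move/eqP => U3_neq0.
  (* Tripling index 2 gives [P_6 * P_2 = s ^+ 3 + 3 * s * t]; cancel [P_2 = s], nonzero because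
     odd. *)
  have P6 : lucas_atom 6 s t = s ^+ 2 + 3 * t.
    apply: (mulIf s_neq0); rewrite -{2}(lucas_atom2 s t) -[6%N]/(3 * 2)%N.
    by rewrite (lucas_atom_mul_prime (power_params3 s t)) // lucas_atom2; ring.
  (* This is [U_6 = P_6 * P_3 * P_2], whose factor [P_2 = s] is odd. If [P_6 = 0], both sides of the
     goal are [+oo], as [U_3] has finite valuation. *)
  have -> : lucas s t 6 = lucas_atom 6 s t * lucas s t 3 * s.
    by rewrite P6 /=; ring.
  rewrite v2_mulr_odd //; have [->|P6_neq0] := eqVneq (lucas_atom 6 s t) 0.
    by rewrite mul0r /v2 eqxx (negPf U3_neq0).
  by rewrite v2M // addeK // /v2 (negPf U3_neq0).
- move=> [|[|h]] // _.
  (* At the tripled parameters the atom of index [2 ^ h.+2] has valuation 1; it is the wanted atom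
     times [P_(2 ^ h.+2)(s, t)], which is odd. *)
  have := v2_mod4 (lucas_atom_2exp_even h s'_even t'_odd).
  rewrite -(lucas_atom_mul_prime (power_params3 s t)) ?(@ltn_exp2l 2 0) //.
    by rewrite v2_mulr_odd // lucas_atom_2exp_odd.
  by rewrite Euclid_dvdX.
- by move=> n n_gt0 n3 n6 n32h; apply: v2_odd; exact: lucas_atom_odd_odd.
Qed.
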